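(* For every $p\ge1$ and $\mu\ge 1$, the price of estimation satisfies $PoE(\mu,p)=\Theta(\mu\log\tilde D)$. Specifically: (i) for every instance $I$ and every assignment $A$, $\max_t\|\ell(I(\mu),A,t)\|_p=O(\mu\log\tilde D)\cdot\max_t\|\ell(I,A,t)\|_p$; (ii) there exist an instance $I$ and an assignment $A$ for which $\max_t\|\ell(I(\mu),A,t)\|_p=\Omega(\mu\log\tilde D)\cdot\max_t\|\ell(I,A,t)\|_p$.
   Context: An instance $I$ consists of $m$ machines and jobs, where job $j$ has an arrival time $t_j$ (an integer), a duration $d_j\in\{1,\dots,\tilde D\}$ (here there are no estimates, so the maximum duration is denoted $\tilde D$), and loads $p_{ij}\in\mathbb{R}_+\cup\{\infty\}$; job $j$ is alive during the time interval from $t_j$ to $t_j+d_j$. An assignment $A$ maps each job to a machine. $\ell(I,A,t)$ is the load vector at time $t$, whose $i$-th coordinate is the sum of $p_{ij}$ over jobs $j$ with $A(j)=i$ alive at time $t$. $I(\mu)$ denotes the same instance in which every job's duration is replaced by $\mu\cdot d_j$ (same arrival times and loads). The price of estimation is $PoE(\mu,p)=\sup_{(I,A)}\frac{\max_t\|\ell(I(\mu),A,t)\|_p}{\max_t\|\ell(I,A,t)\|_p}$, where $\|x\|_p=(\sum_i x_i^p)^{1/p}$.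
   Formalization: The upper bound is for D̃ ≥ 2 (at D̃ = 1, log D̃ = 0 but the ratio is at least 1); the lower bound is for μ ≥ μ0 with any μ0 > 1 and a constant depending only on μ0, since PoE(1,p) = 1 and no constant is uniform as μ → 1. *)

(* Defs.v *)
From mathcomp Require Import all_boot all_order all_algebra.
From mathcomp Require Import all_classical all_reals all_analysis.

Set Implicit Arguments.
Unset Strict Implicit.
Unset Printing Implicit Defensive.

Import Order.TTheory GRing.Theory Num.Theory.
Local Open Scope classical_set_scope.
Local Open Scope ring_scope.
Local Open Scope ereal_scope.

(* Durations are real here, so that I(mu) is again an instance; the standing
   assumption d_j \in {1, ..., D} is the predicate [durations_upto] below. *)
Record instance (R : realType) := Instance {
  nmachines : nat ;
  njobs : nat ;
  arrival : 'I_njobs -> int ;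
  duration : 'I_njobs -> R ;
  jobload : 'I_nmachines -> 'I_njobs -> \bar R ;
  jobload_ge0 : forall i j, 0 <= jobload i j }.

Definition durations_upto (R : realType) (D : nat) (I : instance R) : Prop :=
  forall j : 'I_(njobs I),
    exists d : nat, (1 <= d <= D)%N /\ duration j = (d%:R)%R.

Definition assignment (R : realType) (I : instance R) : Type :=
  'I_(njobs I) -> 'I_(nmachines I).

Definition stretch (R : realType) (mu : R) (I : instance R) : instance R :=
  @Instance R (nmachines I) (njobs I) (@arrival R I)
    (fun j => mu * duration j)%R (@jobload R I) (@jobload_ge0 R I).

(* A job of duration d occupies [t_j, t_j + d): a unit job is alive at exactly
   one integer time. *)
Definition alive (R : realType) (I : instance R) (t : R) (j : 'I_(njobs I))
  : bool :=
  ((arrival j)%:~R <= t < (arrival j)%:~R + duration j)%R.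

Definition load (R : realType) (I : instance R) (A : assignment I) (t : R)
  (i : 'I_(nmachines I)) : \bar R :=
  \sum_(j < njobs I | (A j == i) && alive t j) jobload i j.

Definition pnorm (R : realType) (p : R) (m : nat) (x : 'I_m -> \bar R)
  : \bar R :=
  (\sum_(i < m) x i `^ p) `^ (p^-1)%R.

(* The supremum over t is a maximum: the load vector takes finitely many
   values.  Ranging over integer times t only would give the same value, since
   arrivals are integers and every job alive at t is alive at floor t. *)
Definition maxload (R : realType) (p : R) (I : instance R) (A : assignment I)
  : \bar R :=
  ereal_sup [set pnorm p (load A t) | t in [set: R]].

Definition positive_finite_maxload (R : realType) (p : R) (I : instance R)
  (A : assignment I) : Prop :=
  0 < maxload p A /\ maxload p A < +oo.

Definition maxload_stretch (R : realType) (mu p : R) (I : instance R)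
  (A : assignment I) : \bar R :=
  @maxload R p (stretch mu I) A.

(* Only pairs (I, A) for which the quotient is meaningful (denominator
   different from 0 and +oo) contribute. *)
Definition PoE (R : realType) (D : nat) (mu p : R) : \bar R :=
  ereal_sup [set r | exists (I : instance R) (A : assignment I),
    [/\ durations_upto D I, positive_finite_maxload p A &
        r = maxload_stretch mu p A / maxload p A]].

(* Main.v *)
Require Import Defs.
From mathcomp Require Import all_boot all_order all_algebra.
From mathcomp Require Import all_classical all_reals all_analysis.
From mathcomp Require Import ring lra.

(** Upper bound: group the jobs alive at time [t] in [I(mu)] by the dyadic scale
    [2^k] of their durations and by the window of length [2^k] in which they
    arrived.  All jobs of one group are alive in [I] at one common time, and there
    are only [O(mu log D)] groups, so the load vector at [t] is dominated by a sum
    of that many load vectors of [I].  Convexity of [x^p] then bounds its norm.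

    Lower bound: put unit-load jobs on one machine in disjoint adjacent intervals,
    going backwards from time [0], each job just long enough to survive until [0]
    after stretching.  The durations grow at most by the factor [mu / (mu - 1)],
    so about [(mu - 1) ln D] jobs fit before the duration exceeds [D]. *)

Set Implicit Arguments.
Unset Strict Implicit.
Unset Printing Implicit Defensive.

Import Order.TTheory GRing.Theory Num.Theory.
Local Open Scope ring_scope.
Local Open Scope ereal_scope.

(** * Power means *)

Lemma powR_convex2 (R : realType) (p t a b : R) :
  (1 <= p -> 0 <= t <= 1 -> 0 <= a -> 0 <= b ->
  (t * a + (1 - t) * b) `^ p <= t * a `^ p + (1 - t) * b `^ p)%R.
Proof.
move=> p1 /andP[t0 t1] a0 b0.
have := @convex_powR R p p1 (Itv01 t0 t1) a b.
by rewrite !inE/= !in_itv/= a0 b0 => /(_ isT isT).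
Qed.

(** Jensen's inequality with uniform weights, by induction: adding one value to [n] others gives a
    convex combination of that value, with weight [1 / (n + 1)], and of the old mean. *)
Lemma powR_mean_le (R : realType) (T : Type) (s : seq T) (x : T -> R) (p : R) :
  (1 <= p)%R -> (0 < size s)%N -> (forall k, 0 <= x k)%R ->
  (((\sum_(k <- s) x k) / (size s)%:R) `^ p <=
   (\sum_(k <- s) x k `^ p) / (size s)%:R)%R.
Proof.
move=> p1 + x0; elim: s => // a [|b s] IH _.
  by rewrite !big_seq1 !divr1.
have {IH} := IH isT; set s' := b :: s => IH.
rewrite big_cons [in leRHS]big_cons /= -/s'.
set S := (\sum_(k <- s') x k)%R in IH *.
set P := (\sum_(k <- s') x k `^ p)%R in IH *.
have n0 : (0 < (size s')%:R :> R)%R by rewrite ltr0n.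
have -> : (size s).+2%:R = ((size s')%:R + 1 :> R)%R by rewrite natr1.
set n := (size s')%:R%R in IH n0 *.
have n1 : (n != 0)%R by rewrite gt_eqF.
have n2 : (n + 1 != 0)%R by rewrite gt_eqF// ltr_wpDr.
have -> : ((x a + S) / (n + 1)
           = (n + 1)^-1 * x a + (1 - (n + 1)^-1) * (S / n))%R.
  by field; rewrite n1 n2.
have t01 : (0 <= (n + 1)^-1 <= 1)%R.
  have n3 : (0 < n + 1)%R by rewrite addr_gt0.
  by rewrite invr_ge0 (ltW n3) invf_le1// lerDr ltW.
have Sn : (0 <= S / n)%R by rewrite divr_ge0 ?(ltW n0)// sumr_ge0.
apply: (le_trans (powR_convex2 p1 t01 (x0 a) Sn)).
have -> : ((x a `^ p + P) / (n + 1)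
           = (n + 1)^-1 * x a `^ p + (1 - (n + 1)^-1) * (P / n))%R.
  by field; rewrite n1 n2.
rewrite lerD2l; apply: ler_wpM2l => //.
by rewrite subr_ge0; case/andP: t01.
Qed.

Lemma poweR_sum_le (R : realType) (T : eqType) (s : seq T) (x : T -> \bar R)
    (p : R) :
  (1 <= p)%R -> (0 < size s)%N -> (forall k, 0 <= x k) ->
  (\sum_(k <- s) x k) `^ p <=
  ((size s)%:R `^ p / (size s)%:R)%:E * \sum_(k <- s) x k `^ p.
Proof.
move=> p1 s0 x0.
have p0 : (0 < p)%R by exact: lt_le_trans p1.
have n0 : (0 < (size s)%:R :> R)%R by rewrite ltr0n.
(* An infinite term makes the right side [+oo]; otherwise all terms are real and the power mean
   inequality applies. *)
have [[k [ks xk]]|fin] := pselect (exists k, k \in s /\ x k = +oo).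
  have -> : \sum_(k <- s) x k `^ p = +oo.
    apply/esum_eqyP; first by move=> i _; rewrite gt_eqF ?(lt_le_trans _ (poweR_ge0 _ _)).
    by exists k; rewrite xk poweRyr// gt_eqF.
  by rewrite gt0_muley ?leey// lte_fin divr_gt0// powR_gt0.
have xE k : k \in s -> x k = (fine (x k))%:E.
  move=> ks; rewrite fineK// ge0_fin_numE// ltey.
  by apply/eqP => xk; apply: fin; exists k.
rewrite big_seq [in leRHS]big_seq.
under eq_bigr => k ks do rewrite (xE _ ks).
under [in leRHS]eq_bigr => k ks do rewrite (xE _ ks) poweR_EFin.
rewrite !sumEFin -!big_seq poweR_EFin -EFinM lee_fin.
have f0 k : (0 <= fine (x k))%R by rewrite fine_ge0.
have := @powR_mean_le R T s (fine \o x) p p1 s0 f0.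
have S0 : (0 <= \sum_(k <- s) fine (x k))%R by rewrite sumr_ge0.
rewrite /= powRM ?invr_ge0 ?(ltW n0)// -ler_pdivlMr; last first.
  by rewrite powR_gt0// invr_gt0.
move=> /le_trans; apply.
have -> : ((size s)%:R^-1 `^ p = ((size s)%:R `^ p)^-1 :> R)%R.
  by rewrite -powR_inv1 ?(ltW n0)// -powRrM mulN1r powRN.
by rewrite invrK mulrC mulrCA mulrC.
Qed.

(** Stands in for the triangle inequality. With [n = #|T|], the power mean inequality in each
    coordinate costs a factor [n ^ (p - 1)]; exchanging the sums leaves [n] norms, each at most [M],
    so the [p]-th powers total at most [n ^ p * M ^ p]. *)
Lemma pnorm_sum_le (R : realType) (T : finType) (m : nat) (p : R)
    (x : T -> 'I_m -> \bar R) (y : 'I_m -> \bar R) (M : \bar R) :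
  (1 <= p)%R -> (0 < #|T|)%N -> (forall k i, 0 <= x k i) ->
  (forall i, 0 <= y i <= \sum_k x k i) -> (forall k, pnorm p (x k) <= M) ->
  pnorm p y <= (#|T|%:R)%:E * M.
Proof.
move=> p1 T0 x0 yx xM.
have p0 : (0 < p)%R by exact: lt_le_trans p1.
have pN0 : p != 0%R by rewrite gt_eqF.
have n0 : (0 < #|T|%:R :> R)%R by rewrite ltr0n.
have M0 : 0 <= M.
  by case/card_gt0P: T0 => k _; apply: le_trans (xM k); exact: poweR_ge0.
have sT : size (index_enum T) = #|T| by rewrite cardT enumT.
have -> : #|T|%:R%:E * M = ((#|T|%:R%:E * M) `^ p) `^ p^-1.
  by rewrite -poweRrM mulfV// poweRe1// mule_ge0// lee_fin ltW.
apply: gt0_ler_poweR; first by rewrite invr_ge0 ltW.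
- by rewrite in_itv/= leey andbT sume_ge0// => i _; exact: poweR_ge0.
- by rewrite in_itv/= leey andbT poweR_ge0.
apply: (@le_trans _ _ (\sum_(i < m)
    ((#|T|%:R `^ p / #|T|%:R)%:E * \sum_k x k i `^ p))).
  apply: lee_sum => i _; rewrite -sT.
  apply: le_trans (poweR_sum_le p1 _ (x0 ^~ i)); last by rewrite sT.
  have /andP[y0 yS] := yx i.
  by apply: gt0_ler_poweR => //; rewrite ?(ltW p0)// in_itv/= leey andbT// (le_trans y0).
rewrite -ge0_sume_distrr; last by move=> i _; apply: sume_ge0 => k _; exact: poweR_ge0.
rewrite exchange_big/=.
have xMp k : \sum_(i < m) x k i `^ p <= M `^ p.
  have -> : \sum_(i < m) x k i `^ p = pnorm p (x k) `^ p.
    rewrite /pnorm -poweRrM mulVf// poweRe1// sume_ge0// => i _; exact: poweR_ge0.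
  by apply: gt0_ler_poweR; rewrite ?(ltW p0)// in_itv/= leey andbT// poweR_ge0.
rewrite poweRM ?lee_fin ?(ltW n0)// poweR_EFin.
apply: (@le_trans _ _ ((#|T|%:R `^ p / #|T|%:R)%:E * (#|T|%:R%:E * M `^ p))).
  apply: lee_wpmul2l; first by rewrite lee_fin divr_ge0 ?powR_ge0// ltW.
  have -> : #|T|%:R%:E * M `^ p = \sum_(k : T) M `^ p.
    transitivity (\sum_(k : T) 1 * M `^ p); last by under eq_bigr do rewrite mul1e.
    by rewrite -ge0_sume_distrl// sumEFin sumr_const.
  exact: lee_sum.
by rewrite muleA -EFinM divfK// gt_eqF.
Qed.

Lemma load_ge0 (R : realType) (I : instance R) (A : assignment I) (t : R) i :
  0 <= load A t i.
Proof. by apply: sume_ge0 => j _; exact: jobload_ge0. Qed.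

(** * Upper bound *)

(* A job of duration in [[2^k, 2^(k+1))] that is alive at [t] in [I(mu)] arrived
   within [(t - (q+1) 2^k, t - q 2^k]] for some [q < 2 mu], hence it is alive at
   [t - q 2^k] in [I]. *)
Lemma alive_stretchP (R : realType) (D : nat) (mu : R) (I : instance R) (t : R)
    (j : 'I_(njobs I)) :
  (1 <= mu)%R -> durations_upto D I -> @alive R (stretch mu I) t j ->
  exists (k : 'I_(trunc_log 2 D).+1) (q : 'I_(Num.truncn (2 * mu)%R).+1),
    alive (t - q%:R * 2 ^+ k)%R j.
Proof.
move=> mu1 /(_ j)[d [/andP[d1 dD] dE]] /andP[/= at_ ta].
have k1 := trunc_logP (isT : (1 < 2)%N) d1.
have k2 := trunc_log_ltn d (isT : (1 < 2)%N).
set k := trunc_log 2 d in k1 k2.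
have kD : (k < (trunc_log 2 D).+1)%N by rewrite ltnS leq_trunc_log.
set a := ((arrival j)%:~R)%R in at_ ta.
have e0 : (0 < 2 ^+ k :> R)%R by rewrite exprn_gt0.
have x0 : (0 <= (t - a) / 2 ^+ k)%R by rewrite divr_ge0 ?subr_ge0// ltW.
have /andP[q1 q2] := truncn_itv x0.
set q := Num.truncn _ in q1 q2.
have k1R : (2 ^+ k <= d%:R :> R)%R by rewrite -natrX ler_nat.
have k2R : (d%:R < 2 * 2 ^+ k :> R)%R by rewrite -exprS -natrX ltr_nat.
rewrite dE in ta.
have qmu : (q < (Num.truncn (2 * mu)%R).+1)%N.
  rewrite ltnS le_truncn// ler_pdivrMr//; nra.
exists (Ordinal kD), (Ordinal qmu); rewrite /alive /= dE -/a.
move: q1 q2; rewrite ler_pdivlMr// ltr_pdivrMr// -natr1.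
set Q := (q%:R)%R; move=> q1 q2; apply/andP; split; nra.
Qed.

Lemma load_stretch_le (R : realType) (D : nat) (mu : R) (I : instance R)
    (A : assignment I) (t : R) (i : 'I_(nmachines I)) :
  (1 <= mu)%R -> durations_upto D I ->
  @load R (stretch mu I) A t i <=
  \sum_(u : 'I_(trunc_log 2 D).+1 * 'I_(Num.truncn (2 * mu)%R).+1)
    load A (t - u.2%:R * 2 ^+ u.1)%R i.
Proof.
move=> mu1 ID; rewrite /load.
under [in leRHS]eq_bigr do rewrite big_mkcond.
rewrite big_mkcond exchange_big/=; apply: lee_sum => j _.
(* After the exchange it suffices to compare job by job: a job alive at [t] in the stretched
   instance occurs in at least one term on the right, and repetitions only add load. *)
have g0 (b : bool) : 0 <= (if b then jobload i j else 0).
  by case: b => //; exact: jobload_ge0.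
case: ifPn => [/andP[Aj aj]|_]; last by apply: sume_ge0.
have [k [q akq]] := alive_stretchP mu1 ID aj.
rewrite (bigD1 (k, q))//= Aj akq/=.
by rewrite leeDl// sume_ge0.
Qed.

(** The 6 is 2 times 3: [D >= 2] makes the logarithm [K] at least 1, so [K + 1 <= 2 * K], and
    [mu >= 1] gives [2 * mu + 1 <= 3 * mu]. *)
Lemma window_count_le (R : realType) (mu : R) (D : nat) :
  (1 <= mu)%R -> (2 <= D)%N ->
  (((trunc_log 2 D).+1 * (Num.truncn (2 * mu)%R).+1)%N%:R
   <= 6 / ln 2 * (mu * ln (D%:R : R)))%R.
Proof.
move=> mu1 D2.
have ln20 : (0 < ln 2 :> R)%R by rewrite ln_gt0// ltr1n.
have kD := trunc_logP (isT : (1 < 2)%N) (ltnW D2).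
have k1 : (1 <= trunc_log 2 D)%N by apply: trunc_log_max.
have D0 : (0 < D%:R :> R)%R by rewrite ltr0n (ltnW D2).
have klnD : ((trunc_log 2 D)%:R * ln 2 <= ln (D%:R : R))%R.
  rewrite mulrC mulr_natr -lnXn// ler_ln ?posrE ?exprn_gt0//.
  by rewrite -natrX ler_nat.
have : ((Num.truncn (2 * mu)%R)%:R <= 2 * mu)%R by rewrite truncn_le; nra.
have : (1 <= (trunc_log 2 D)%:R :> R)%R by rewrite ler1n.
move: klnD; rewrite -ler_pdivlMr// natrM.
rewrite -[(trunc_log 2 D).+1%:R]natr1 -[(Num.truncn _).+1%:R]natr1.
set K := ((trunc_log 2 D)%:R)%R; set Q := ((Num.truncn _)%:R)%R => KL K1 Qmu.
have Q0 : (0 <= Q)%R by rewrite ler0n.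
have -> : (6 / ln 2 * (mu * ln D%:R) = (2 * (ln D%:R / ln 2)) * (3 * mu) :> R)%R.
  by ring.
by apply: ler_pM; lra.
Qed.

Lemma maxload_ge0 (R : realType) (p : R) (I : instance R) (A : assignment I) :
  0 <= maxload p A.
Proof.
apply: (@le_trans _ _ (pnorm p (load A 0%R))); first exact: poweR_ge0.
by apply: ereal_sup_ubound; exists 0%R.
Qed.

Lemma maxload_stretch_le (R : realType) (p mu : R) (D : nat) (I : instance R)
    (A : assignment I) :
  (1 <= p)%R -> (1 <= mu)%R -> (2 <= D)%N -> durations_upto D I ->
  maxload_stretch mu p A <= (6 / ln 2 * (mu * ln (D%:R : R)))%:E * maxload p A.
Proof.
move=> p1 mu1 D2 ID; apply: ge_ereal_sup => _ [t _ <-].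
pose T := ('I_(trunc_log 2 D).+1 * 'I_(Num.truncn (2 * mu)%R).+1)%type.
have cT : #|{: T}| = ((trunc_log 2 D).+1 * (Num.truncn (2 * mu)%R).+1)%N.
  by rewrite card_prod !card_ord.
apply: (@le_trans _ _ (#|{: T}|%:R%:E * maxload p A)); last first.
  apply: lee_wpmul2r; first exact: maxload_ge0.
  by rewrite lee_fin cT window_count_le.
apply: (@pnorm_sum_le _ _ _ _ (fun u : T => load A (t - u.2%:R * 2 ^+ u.1)%R)) => //.
- by rewrite cT.
- by move=> u i; exact: load_ge0.
- by move=> i; rewrite load_ge0 load_stretch_le.
- by move=> u; apply: ereal_sup_ubound; eexists.
Qed.

(** * Lower bound *)

(* Reading backwards from time [0], [chain_start mu n] is the distance to [0] of
   the arrival of the [n]-th job: consecutive jobs are adjacent, and the next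
   duration [d] is the least one with [s + d < mu * d], where [s] is the length
   used so far. *)
Fixpoint chain_start (R : realType) (mu : R) (n : nat) : nat :=
  if n is n'.+1 then
    (chain_start mu n' + (Num.truncn ((chain_start mu n')%:R / (mu - 1))%R).+1)%N
  else 0%N.

Arguments chain_start : simpl never.

Definition chain_dur (R : realType) (mu : R) (n : nat) : nat :=
  (Num.truncn ((chain_start mu n)%:R / (mu - 1))%R).+1.

Definition chain_instance (R : realType) (mu : R) (N : nat) : instance R :=
  @Instance R 1 N (fun j => - (chain_start mu j.+1)%:Z)%R
    (fun j => (chain_dur mu j)%:R%R) (fun _ _ => 1) (fun _ _ => lee01).

Definition chain_assignment (R : realType) (mu : R) (N : nat) :
  assignment (chain_instance mu N) := fun=> ord0.

Arguments chain_assignment {R} mu N _.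

Section Chain.
Variables (R : realType) (mu : R).
Hypothesis mu1 : (1 < mu)%R.

Let nu0 : (0 < mu - 1)%R. Proof. by rewrite subr_gt0. Qed.

Lemma chain_startS n : chain_start mu n.+1 = (chain_start mu n + chain_dur mu n)%N.
Proof. by []. Qed.

(** The successor of a truncation strictly exceeds the truncated number. Strictness matters: a job
    is no longer alive at its right endpoint, and it must be alive at time 0. *)
Lemma chain_start_lt_dur n :
  ((chain_start mu n.+1)%:R < mu * (chain_dur mu n)%:R)%R.
Proof.
have := truncnS_gt ((chain_start mu n)%:R / (mu - 1))%R.
by rewrite -/(chain_dur mu n) ltr_pdivrMr// chain_startS natrD; lra.
Qed.

Lemma chain_dur_le n : ((chain_dur mu n)%:R <= (chain_start mu n)%:R / (mu - 1) + 1)%R.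
Proof. by rewrite -natr1 lerD2r truncn_le divr_ge0 ?ler0n// ltW. Qed.

(** The left side bounds the next duration, so appending that job multiplies it by at most
    [1 + 1 / (mu - 1)], which is [mu / (mu - 1)]. *)
Lemma chain_start_geom n :
  ((chain_start mu n)%:R / (mu - 1) + 1 <= (1 + (mu - 1)^-1) ^+ n)%R.
Proof.
elim: n => [|n IH]; first by rewrite expr0 mul0r add0r.
rewrite chain_startS natrD exprS.
have v0 : (0 < (mu - 1)^-1)%R by rewrite invr_gt0.
have dv := ler_wpM2r (ltW v0) (chain_dur_le n).
have := ler_wpM2r (ltW v0) IH.
by rewrite mulrDl; lra.
Qed.

Lemma chain_dur_le_expR n : ((chain_dur mu n)%:R <= expR (n%:R / (mu - 1)))%R.
Proof.
apply: (le_trans (chain_dur_le n)); apply: (le_trans (chain_start_geom n)).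
rewrite mulrC expRM_natr lerXn2r ?nnegrE ?expR_ge0//; last exact: expR_ge1Dx.
by rewrite addr_ge0// invr_ge0 ltW.
Qed.

Lemma chain_start_le m n : (m <= n)%N -> (chain_start mu m <= chain_start mu n)%N.
Proof.
move=> /subnKC <-; elim: (n - m)%N => [|k IH]; first by rewrite addn0.
by rewrite addnS chain_startS (leq_trans IH)// leq_addr.
Qed.

Lemma chain_aliveE N t (j : 'I_N) : @alive R (chain_instance mu N) t j =
  (- (chain_start mu j.+1)%:R <= t < - (chain_start mu j)%:R)%R.
Proof.
by rewrite /alive /= mulrNz -pmulrn chain_startS natrD opprD addrNK.
Qed.

Lemma chain_alive_inj N t (i j : 'I_N) :
  @alive R (chain_instance mu N) t i -> @alive R (chain_instance mu N) t j -> i = j.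
Proof.
have main (a b : 'I_N) : (a < b)%N ->
    @alive R (chain_instance mu N) t a -> @alive R (chain_instance mu N) t b -> False.
  rewrite !chain_aliveE => ab /andP[h1 _] /andP[_ h2].
  (* Larger indices lie further in the past: job [b] has ended by the time job [a] arrives. *)
  have : ((chain_start mu a.+1)%:R <= (chain_start mu b)%:R :> R)%R.
    by rewrite ler_nat chain_start_le.
  by lra.
move=> hi hj; apply/val_inj; case: (ltngtP i j) => // ij.
- by case: (main _ _ ij hi hj).
- by case: (main _ _ ij hj hi).
Qed.

Lemma chain_load_le1 N t i : load (chain_assignment mu N) t i <= 1.
Proof.
rewrite /load.
have [j aj|al] := pickP (@alive R (chain_instance mu N) t); last first.
  by rewrite big_pred0// => j; rewrite al andbF.
rewrite (big_pred1 j)// => k; rewrite [i]ord1 /=.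
by apply/idP/eqP => [ak|->//]; exact: chain_alive_inj ak aj.
Qed.

(** The first job has duration 1 and occupies [[-1, 0)], so the maximum load of the chain is not
    0. *)
Lemma chain_load_ge1 N : 1 <= load (chain_assignment mu N.+1) (-1)%R ord0.
Proof.
rewrite /load (bigD1 ord0); first by rewrite leeDl// sume_ge0.
rewrite eqxx chain_aliveE /=.
have -> : chain_start mu 1 = 1%N by rewrite chain_startS /chain_dur mul0r truncn0.
by rewrite lexx oppr0 ltrN10.
Qed.

Lemma chain_stretch_load N :
  @load R (stretch mu (chain_instance mu N)) (chain_assignment mu N) 0%R ord0
  = N%:R%:E.
Proof.
rewrite /load (eq_bigl xpredT) => [|j]; first by rewrite sumEFin sumr_const card_ord.
have := chain_start_lt_dur j; have : (0 <= (chain_start mu j.+1)%:R :> R)%R by [].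
rewrite /alive /= mulrNz -pmulrn.
set a := _%:R%R; set b := (mu * _)%R => a0 ab.
by apply/andP; split; lra.
Qed.

End Chain.

Lemma pnorm1 (R : realType) (p : R) (x : 'I_1 -> \bar R) :
  (1 <= p)%R -> 0 <= x ord0 -> pnorm p x = x ord0.
Proof.
move=> p1 x0; rewrite /pnorm big_ord1 -poweRrM mulfV ?poweRe1//.
by rewrite gt_eqF// (lt_le_trans _ p1).
Qed.

Lemma chain_maxload (R : realType) (p mu : R) (N : nat) :
  (1 <= p)%R -> (1 < mu)%R -> maxload p (chain_assignment mu N.+1) = 1.
Proof.
move=> p1 mu1; apply/eqP; rewrite eq_le; apply/andP; split.
  apply: ge_ereal_sup => _ [t _ <-].
  by rewrite pnorm1 ?load_ge0// chain_load_le1.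
apply: (le_trans (chain_load_ge1 mu N)).
by apply: ereal_sup_ubound; exists (-1)%R => //; rewrite pnorm1 ?load_ge0.
Qed.

Lemma chain_maxload_stretch_ge (R : realType) (p mu : R) (N : nat) :
  (1 <= p)%R -> (1 < mu)%R ->
  N%:R%:E <= maxload_stretch mu p (chain_assignment mu N).
Proof.
move=> p1 mu1; rewrite -(chain_stretch_load mu1 N).
by apply: ereal_sup_ubound; exists 0%R => //; rewrite pnorm1 ?load_ge0.
Qed.

Lemma exists_maxload_stretch_ge (R : realType) (p mu : R) (D : nat) :
  (1 <= p)%R -> (1 < mu)%R -> (1 <= D)%N ->
  exists (I : instance R) (A : assignment I),
    [/\ durations_upto D I, positive_finite_maxload p A &
        ((mu - 1) * ln (D%:R : R))%:E * maxload p A <= maxload_stretch mu p A].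
Proof.
move=> p1 mu1 D1.
have nu0 : (0 < mu - 1)%R by rewrite subr_gt0.
have lnD : (0 <= ln (D%:R : R))%R by rewrite ln_ge0// ler1n.
(* [N] is the last index for which the exponential bound keeps the duration at most [D]. Indices
   start at 0, so there are [N + 1] jobs, more than [(mu - 1) * ln D]. *)
pose N := Num.truncn ((mu - 1) * ln (D%:R : R))%R.
have ND : (N%:R <= (mu - 1) * ln (D%:R : R))%R.
  by rewrite truncn_le mulr_ge0// ltW.
exists (chain_instance mu N.+1), (chain_assignment mu N.+1).
split; rewrite /positive_finite_maxload ?chain_maxload//.
- move=> j; exists (chain_dur mu j); split=> //=.
  rewrite -(ler_nat R); apply: (le_trans (chain_dur_le_expR mu1 j)).
  rewrite -[leRHS]lnK ?posrE ?ltr0n// ler_expR ler_pdivrMr// mulrC.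
  by apply: le_trans ND; rewrite ler_nat -ltnS.
- by split; [exact: lte01|exact: ltry].
- rewrite mule1; apply: le_trans (chain_maxload_stretch_ge _ p1 mu1).
  by rewrite lee_fin ltW// truncnS_gt.
Qed.

(** * Price of estimation *)

Lemma ler_ratio_maxload (R : realType) (p c : R) (I : instance R)
    (A : assignment I) (x : \bar R) : positive_finite_maxload p A ->
  ((c%:E <= x / maxload p A) = (c%:E * maxload p A <= x)) *
  ((x / maxload p A <= c%:E) = (x <= c%:E * maxload p A)).
Proof.
rewrite /positive_finite_maxload; case: (maxload p A) => [r||] [] //.
rewrite lte_fin => r0 _.
by rewrite inver gt_eqF// lee_pdivlMr// lee_pdivrMr.
Qed.

(** The lower constant depends on [mu0 > 1] because at [mu = 1] stretching changes nothing and the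
    quotient is 1 for every [D]. The upper bound starts at [D = 2] because [ln 1 = 0]. *)
Theorem theorem3 (R : realType) :
  (exists C : R, (0 < C)%R /\
    forall (p mu : R) (D : nat), (1 <= p)%R -> (1 <= mu)%R -> (2 <= D)%N ->
      PoE D mu p <= (C * (mu * ln (D%:R : R)))%:E /\
      forall (I : instance R) (A : assignment I), durations_upto D I ->
        maxload_stretch mu p A
          <= (C * (mu * ln (D%:R : R)))%:E * maxload p A)
  /\
  (forall mu0 : R, (1 < mu0)%R ->
   exists c : R, (0 < c)%R /\
    forall (p mu : R) (D : nat), (1 <= p)%R -> (mu0 <= mu)%R -> (1 <= D)%N ->
      (c * (mu * ln (D%:R : R)))%:E <= PoE D mu p /\
      exists (I : instance R) (A : assignment I),
        [/\ durations_upto D I, positive_finite_maxload p A &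
            (c * (mu * ln (D%:R : R)))%:E * maxload p A
              <= maxload_stretch mu p A]).
Proof.
split.
  exists (6 / ln 2)%R; split.
    by rewrite divr_gt0// ln_gt0// ltr1n.
  move=> p mu D p1 mu1 D2; split; last by move=> I A; exact: maxload_stretch_le.
  apply: ge_ereal_sup => _ [I [A [ID pf ->]]].
  by rewrite ler_ratio_maxload// maxload_stretch_le.
(* The chain yields the factor [mu - 1], which equals [(1 - 1 / mu) * mu] and is at least
   [(1 - 1 / mu0) * mu]. *)
move=> mu0 mu01; exists (1 - mu0^-1)%R; split.
  by rewrite subr_gt0 invf_lt1// (lt_trans _ mu01).
move=> p mu D p1 mumu0 D1.
have mu1 : (1 < mu)%R by exact: lt_le_trans mumu0.
have [I [A [ID pf le]]] := exists_maxload_stretch_ge p1 mu1 D1.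
have {le} le : ((1 - mu0^-1) * (mu * ln (D%:R : R)))%:E * maxload p A
    <= maxload_stretch mu p A.
  apply: le_trans le; apply: lee_wpmul2r; first exact: maxload_ge0.
  rewrite lee_fin mulrA ler_wpM2r ?ln_ge0 ?ler1n//.
  rewrite mulrBl mul1r lerB// mulrC ler_pdivlMr ?mul1r//.
  exact: lt_trans mu01.
split; last by exists I, A.
rewrite -(ler_ratio_maxload _ _ pf) in le.
by apply: le_trans le _; apply: ereal_sup_ubound; exists I, A.
Qed.
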